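(* Let $(X,\mu)$ be a standard non-atomic probability space, let $\mathcal{T}$ be the set of all measure-preserving transformations on $(X,\mu)$, and let $\mathcal{T}_{\mathrm{inv}}\subset\mathcal{T}$ be the set of all invertible ones. Endow $\mathcal{T}$ with the strong operator topology for the corresponding Koopman operators on $L^2(X,\mu)$ (which on $\mathcal{T}$ coincides with the weak operator topology). Then $\mathcal{T}_{\mathrm{inv}}$ is a dense $G_\delta$ subset of $\mathcal{T}$.
   Context: A measure-preserving transformation on $(X,\mu)$ is a measurable map $T:X\to X$ with $\mu(T^{-1}(A))=\mu(A)$ for every measurable $A\subset X$; it need not be invertible. Its Koopman operator on $L^2(X,\mu)$ (real or complex scalars), denoted by the same letter, is the isometry $(Tf)(x):=f(Tx)$. Transformations are identified with their Koopman operators, so transformations that agree $\mu$-almost everywhere are identified. A transformation $T$ is called invertible if it is essentially invertible, i.e. there is a measure-preserving $S:X\to X$ with $S\circ T=T\circ S=\mathrm{id}$ $\mu$-almost everywhere; equivalently, its Koopman operator is invertible (unitary). The strong operator topology on $\mathcal{T}$ is the topology in which $T_\alpha\to T$ iff $\|T_\alpha f-Tf\|_{L^2}\to 0$ for every $f\in L^2(X,\mu)$; the weak operator topology is the one in which $T_\alpha\to T$ iff $\langle T_\alpha f,g\rangle\to\langle Tf,g\rangle$ for all $f,g\in L^2(X,\mu)$. *)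

(* Defs.v *)
From HB Require Import structures.
From mathcomp Require Import all_boot all_order all_algebra finmap.
From mathcomp Require Import all_classical all_reals all_analysis.
From mathcomp Require Import measurable_realfun.
From mathcomp Require Export borel_hierarchy.

Set Implicit Arguments.
Unset Strict Implicit.
Unset Printing Implicit Defensive.

Import Order.TTheory GRing.Theory Num.Theory.
Import numFieldNormedType.Exports.

Local Open Scope classical_set_scope.
Local Open Scope ring_scope.

(* The sigma-algebra of X is that of the Borel sets of some Polish space Y,
   transported along a bijection. A Hausdorff pseudometric is a metric, so Y is
   a separable complete metric space. *)
Definition standard_borel (R : realType) d (X : measurableType d) : Prop :=
  exists (Y : completePseudoMetricType R) (phi : X -> Y),
    [/\ hausdorff_space Y,
        exists2 D : set Y, countable D & dense D,
        bijective phi &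
        forall A : set X,
          measurable A <-> exists2 B : set Y, <<s @open Y >> B & A = phi @^-1` B].

Definition non_atomic (R : realType) d (X : measurableType d)
    (mu : probability X R) : Prop :=
  forall A : set X, measurable A -> (0 < mu A)%E ->
    exists B : set X, [/\ measurable B, B `<=` A, (0 < mu B)%E & (mu B < mu A)%E].

Section transformations.
Context (R : realType) d (X : measurableType d) (mu : probability X R).

Definition measure_preserving (T : X -> X) : Prop :=
  measurable_fun setT T /\
  forall A : set X, measurable A -> mu (T @^-1` A) = mu A.

(* Almost everywhere equality classes of measure-preserving transformations,
   as a subtype of the classes {mfun_ mu, X >-> X} of measurable maps, which
   coerce to functions through a representative. All the notions below are
   insensitive to the choice of the representative. The type mpt carries the
   strong operator topology, its alias mpt_weak the weak one. *)
Record mpt : Type := MPT {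
  mpt_class :> {mfun_ mu, X >-> X};
  mpt_preserving : `[< measure_preserving mpt_class >] }.

HB.instance Definition _ := [isSub for mpt_class].
HB.instance Definition _ := [Choice of mpt by <:].

Definition essentially_invertible (T : X -> X) : Prop :=
  exists S : X -> X, [/\ measure_preserving S,
    {ae mu, forall x, S (T x) = x} & {ae mu, forall x, T (S x) = x}].

Definition mpt_inv : set mpt := [set T | essentially_invertible T].

Definition koopman (T : X -> X) (f : X -> R) : X -> R := f \o T.

Definition strong_dist (f : X -> R) (S T : mpt) : \bar R :=
  'N[mu]_2%:E[EFin \o (koopman S f \- koopman T f)].

Definition inner_L2 (f g : X -> R) : R := \int[mu]_x (f x * g x).

Definition strong_ball (f : X -> R) (T : mpt) (e : R) : set mpt :=
  [set S | (strong_dist f S T < e%:E)%E].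

Definition weak_ball (f g : X -> R) (T : mpt) (e : R) : set mpt :=
  [set S | `|inner_L2 (koopman S f) g - inner_L2 (koopman T f) g| < e].

Definition strong_subbase : set (set mpt) :=
  [set U | exists f T e, [/\ f \in Lfun mu 2%:E, 0 < e & U = strong_ball f T e]].

Definition weak_subbase : set (set mpt) :=
  [set U | exists f g T e, [/\ f \in Lfun mu 2%:E, g \in Lfun mu 2%:E,
    0 < e & U = weak_ball f g T e]].

HB.instance Definition _ :=
  isSubBaseTopological.Build mpt strong_subbase id.

Definition mpt_weak : Type := mpt.
HB.instance Definition _ := Choice.on mpt_weak.
HB.instance Definition _ :=
  isSubBaseTopological.Build mpt_weak weak_subbase id.

Definition weak_open : set (set mpt) := @open mpt_weak.

Let cvg_strong_subbase (F : set_system mpt) (T : mpt) : Filter F ->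
  F --> T <-> forall U, strong_subbase U -> U T -> F U.
Proof.
move=> FF; split=> [FT U sU UT|H A].
  apply: FT; apply: (@open_nbhs_nbhs mpt); split => //.
  exists [set U]; last by rewrite bigcup_set1.
  move=> _ ->; exists [fset U]%fset => //=.
    by move=> V; rewrite inE inE => /eqP ->.
  by rewrite set_fset1 bigcap_set1.
rewrite /= (@nbhsE mpt) => -[_ [[B sB <-] [C BC CT]] sBA].
rewrite nbhs_filterE; apply: filterS sBA _; apply: (@filterS _ _ _ C).
  by move=> ? ?; exists C.
have [D sD DC] := sB _ BC; rewrite -DC; apply: filter_bigI => E DE.
by apply: H; [exact/set_mem/sD|move: CT; rewrite -DC; exact].
Qed.

Let cvg_weak_subbase (F : set_system mpt_weak) (T : mpt_weak) : Filter F ->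
  F --> T <-> forall U, weak_subbase U -> U T -> F U.
Proof.
move=> FF; split=> [FT U sU UT|H A].
  apply: FT; apply: (@open_nbhs_nbhs mpt_weak); split => //.
  exists [set U]; last by rewrite bigcup_set1.
  move=> _ ->; exists [fset U]%fset => //=.
    by move=> V; rewrite inE inE => /eqP ->.
  by rewrite set_fset1 bigcap_set1.
rewrite /= (@nbhsE mpt_weak) => -[_ [[B sB <-] [C BC CT]] sBA].
rewrite nbhs_filterE; apply: filterS sBA _; apply: (@filterS _ _ _ C).
  by move=> ? ?; exists C.
have [D sD DC] := sB _ BC; rewrite -DC; apply: filter_bigI => E DE.
by apply: H; [exact/set_mem/sD|move: CT; rewrite -DC; exact].
Qed.

Lemma strong_cvgP (F : set_system mpt) (T : mpt) : Filter F ->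
  F --> T <-> forall f, f \in Lfun mu 2%:E -> forall e, 0 < e ->
    \forall S \near F, (strong_dist f S T < e%:E)%E.
Proof.
move=> FF; rewrite cvg_strong_subbase; split=> [H f fL e e0|H U [f[T0[e[fL e0 ->{U}]]]] /= dT].
  apply: (H (strong_ball f T e)); first by exists f, T, e.
  rewrite /strong_ball/= /strong_dist (_ : _ \o _ = cst 0%E) ?Lnorm0 ?lte_fin//.
  by apply/funext => x /=; rewrite subrr.
have m (S : mpt) : measurable_fun setT (koopman S f).
  case: S => S /asboolP[/= mS _]; apply: measurableT_comp => //.
  by move: fL; rewrite inE => /andP[/[!inE]].
have dN (S S' : mpt) : (0 <= strong_dist f S S')%E by exact: Lnorm_ge0.
have tri S : (strong_dist f S T0 <= strong_dist f S T + strong_dist f T T0)%E.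
  rewrite /strong_dist.
  rewrite (_ : EFin \o (koopman S f \- koopman T0 f) =
      (EFin \o ((koopman S f \- koopman T f) \+ (koopman T f \- koopman T0 f)))).
    by apply: eminkowski; rewrite ?lee1n//; exact: measurable_funB.
  by apply/funext => x /=; rewrite addrA subrK.
have dfin : strong_dist f T T0 \is a fin_num.
  by rewrite ge0_fin_numE// (lt_trans dT) ?ltry.
have := H f fL (e - fine (strong_dist f T T0)).
rewrite subr_gt0 -lte_fin fineK// => /(_ dT).
apply: filterS => S h; apply: (le_lt_trans (tri S)).
by rewrite -lteBrDr// (lt_le_trans h)// EFinB fineK.
Qed.

Lemma weak_cvgP (F : set_system mpt_weak) (T : mpt_weak) : Filter F ->
  F --> T <-> forall f g, f \in Lfun mu 2%:E -> g \in Lfun mu 2%:E ->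
    inner_L2 (koopman S f) g @[S --> F] --> inner_L2 (koopman T f) g.
Proof.
move=> FF; rewrite cvg_weak_subbase; split=> [H f g fL gL|H U].
  apply/cvgrPdist_lt => e e0; have := H (weak_ball f g T e) _ _.
  under eq_near do rewrite distrC.
  by apply; [exists f, g, T, e|rewrite /weak_ball/= subrr normr0].
move=> [f [g [T0 [e [fL gL e0 ->{U}]]]]] /= dT.
have /cvgrPdist_lt/(_ (e - `|inner_L2 (koopman T f) g - inner_L2 (koopman T0 f) g|)) :=
  H f g fL gL.
rewrite subr_gt0 => /(_ dT); apply: filterS => S; rewrite distrC ltrBrDr.
by apply: le_lt_trans; rewrite (le_trans _ (ler_normD _ _))// addrA subrK.
Qed.

Lemma mpt_ae_eq (S T : mpt) : {ae mu, forall x, S x = T x} -> S = T.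
Proof.
move=> ST; apply: val_inj => /=.
rewrite -[mpt_class S]reprK -[mpt_class T]reprK; apply/eqmodP/asboolP.
by apply: filterS ST => x /= STx _.
Qed.

Let preserving_ae (S T : X -> X) : measurable_fun setT S ->
  {ae mu, forall x, S x = T x} -> measure_preserving T -> measure_preserving S.
Proof.
move=> mS ST [mT pT]; split=> // A mA; rewrite -(pT A mA).
have mSA : measurable (S @^-1` A) by rewrite -[_ @^-1` _]setTI; exact: mS.
have mTA : measurable (T @^-1` A) by rewrite -[_ @^-1` _]setTI; exact: mT.
have le (U V : X -> X) : measurable (U @^-1` A) -> measurable (V @^-1` A) ->
    {ae mu, forall x, U x = V x} -> (mu (U @^-1` A) <= mu (V @^-1` A))%E.
  move=> mU mV [N [mN N0 UVN]].
  rewrite -[leRHS]adde0 -N0 (le_trans _ (measureU2 _ mV mN))//.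
  apply: le_measure; rewrite ?inE//; first exact: measurableU.
  move=> x /= Ux; have [xN|xN] := pselect (N x); [by right|left].
  by rewrite -[V x](_ : U x = V x)//; apply: contrapT => UV; exact/xN/UVN.
by apply/eqP; rewrite eq_le !le//; apply: filterS ST.
Qed.

Lemma mpt_of_fun (T : X -> X) : measure_preserving T ->
  exists c : mpt, {ae mu, forall x, c x = T x}.
Proof.
move=> pT; have [mT _] := pT.
pose m : {mfun X >-> X} := HB.pack T (isMeasurableFun.Build _ _ _ _ T mT).
pose q : {mfun_ mu, X >-> X} := \pi%qT m.
have qT : {ae mu, forall x, q x = T x}.
  have /eqmodP/asboolP : repr q = m %[mod {mfun_ mu, X >-> X}]%qT by rewrite reprK.
  by apply: filterS => x /= /(_ I).
have pq : `[< measure_preserving q >].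
  by apply/asboolP; apply: preserving_ae qT pT; exact: measurable_funP.
by exists (MPT pq).
Qed.

End transformations.
Arguments mpt_inv {R d X} mu.

(* Main.v *)
(** On both topologies a Koopman operator is an isometry, so that
    |Sf - Tf|^2 = 2 (<Tf, Tf> - <Sf, Tf>), and weak convergence to T is strong
    convergence.

    Density: let l : X -> nat be a measurable labelling of X. Injecting X into
    ]0, 1[ by a base three expansion g and applying to l + g its own
    distribution function (continuous, since mu has no atoms) gives u : X -> R
    which is uniformly distributed, loses no measurable set modulo null sets, and
    satisfies l < j iff u <= mu(l < j) almost everywhere. Doing the same with
    l o T gives v. Then S = u^-1 o v is invertible and l o S = l o T almost
    everywhere. Taking for l the integer part of a large multiple of f makes Sf
    uniformly close to Tf.

    G_delta: let A_n generate the sigma-algebra. If T lies, for all n and m, in a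
    ball of radius 2^-(m+1) for the indicator of some set B, centered at an
    invertible S with S^-1(B) = A_n, then A_n is a preimage by T modulo null sets
    by Borel-Cantelli; hence so is every measurable set, and T has an inverse.

    Both parts rest on the same point realization: a measurable map u from a
    standard Borel space for which every measurable set is a preimage modulo null
    sets has a measurable left inverse almost everywhere. *)
Require Import Defs.
From HB Require Import structures.
From mathcomp Require Import all_boot all_order all_algebra.
From mathcomp Require Import all_classical all_reals all_analysis.
From mathcomp Require Import borel_hierarchy measurable_realfun.
From mathcomp Require Import ring lra.

Set Implicit Arguments.
Unset Strict Implicit.
Unset Printing Implicit Defensive.

Import Order.TTheory GRing.Theory Num.Theory.
Import numFieldNormedType.Exports.

Local Open Scope classical_set_scope.
Local Open Scope ring_scope.

(** * Separability and covers by small open cells *)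

Lemma dense_sequence (R : realType) (Y : completePseudoMetricType R)
    (D : set Y) : countable D -> dense D ->
  exists q : nat -> Y, forall e, 0 < e -> forall y, exists i, ball (q i) e y.
Proof.
move=> /countable_injP[f finj] dD.
(* The injection [f] of [D] into the naturals is inverted; indices outside its image get the default
   [point]. *)
exists (fun i => xget point [set y | D y /\ f y = i]) => e e0 y.
have [] := dD (ball y e)° _ (open_interior _).
  by exists y; apply: nbhs_singleton; apply: nbhs_interior; exact: nbhsx_ballx.
move=> z [/interior_subset yz Dz]; exists (f z).
rewrite (_ : xget _ _ = z); first exact: ball_sym.
case: xgetP => [z' _ [Dz' fz]|/(_ z)/= []//].
by apply: finj; rewrite ?inE.
Qed.

Section sequence_of_balls.
Context (R : realType) (Y : completePseudoMetricType R) (q : nat -> Y).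
Hypothesis dense_q : forall e, 0 < e -> forall y, exists i, ball (q i) e y.

(* Balls of a pseudometric space of the library need not be open. *)
Definition cell n i : set Y := (ball (q i) n.+1%:R^-1)°.

Lemma cell_ball n i y : cell n i y -> ball (q i) n.+1%:R^-1 y.
Proof. exact: interior_subset. Qed.

Lemma cell_cover n y : exists i, cell n i y.
Proof.
have e0 : 0 < n.+1%:R^-1 / 2 :> R by rewrite divr_gt0.
have [i qy] := dense_q e0 y; exists i.
apply/nbhs_ballP; exists (n.+1%:R^-1 / 2) => //= z yz.
by apply: ball_split yz.
Qed.

Lemma small_radius (c e : R) : 0 < e -> exists n, c * n.+1%:R^-1 < e.
Proof.
move=> e0; exists (Num.truncn (c / e)).
by rewrite ltr_pdivrMr// mulrC -ltr_pdivrMr// truncnS_gt.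
Qed.

Lemma open_bigcup_cell (U : set Y) (c : R) : 1 <= c -> open U ->
  U = \bigcup_(ni in [set ni : nat * nat | ball (q ni.2) (c * ni.1.+1%:R^-1) `<=` U])
        cell ni.1 ni.2.
Proof.
move=> c1; rewrite openE => oU; apply/seteqP; split=> [y Uy|y [[n i]]/=].
  have /nbhs_ballP[e /= e0 yU] := oU _ Uy.
  (* Two legs, from [y] to [q i] and from [q i] to [z], each cost at most [c / (n + 1)]. *)
  have [n ne] := small_radius (c * 2) e0.
  have [i niy] := cell_cover n y; exists (n, i) => //= z qz; apply: yU.
  apply: (le_ball (ltW ne)); rewrite mulrAC mulr_natr mulr2n.
  apply: ball_triangle qz; apply/ball_sym/(le_ball _ (cell_ball niy)).
  by rewrite ler_peMl.
move=> qU /cell_ball qy; apply: qU; apply: le_ball qy.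
by rewrite ler_peMl.
Qed.

End sequence_of_balls.

(** * Measurability through countable unions and generators *)

Lemma countable_bigcup_measurable d (X : measurableType d) (I : countType)
    (P : set I) (F : I -> set X) :
  (forall i, P i -> measurable (F i)) -> measurable (\bigcup_(i in P) F i).
Proof.
move=> mF; rewrite bigcup_mkcond; apply: countable_bigcupT_measurable => // i.
by case: ifPn => [/set_mem/mF|].
Qed.

Lemma measurable_preimage d d' (X : measurableType d) (Z : measurableType d')
    (f : X -> Z) (A : set Z) :
  measurable_fun setT f -> measurable A -> measurable (f @^-1` A).
Proof. by move=> mf mA; rewrite -[_ @^-1` _]setTI; exact: mf. Qed.

Lemma preimage_measurable_sigma d (X : measurableType d) (Y : Type)
    (G : set (set Y)) (f : X -> Y) :
  (forall A, G A -> measurable (f @^-1` A)) ->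
  forall A, <<s G >> A -> measurable (f @^-1` A).
Proof.
move=> mf A; apply: (@smallest_sub _ _ _ [set B | measurable (f @^-1` B)]) => /=;
  last exact: mf.
split=> [|B mB|F mF]; rewrite /= ?preimage_set0//.
- by rewrite /= setTD -preimage_setC; exact: measurableC.
- by rewrite /= preimage_bigcup; exact: bigcupT_measurable.
Qed.

(** * Measurable left inverses on standard Borel spaces *)

Section left_inverse.
Context (R : realType) d (X : measurableType d) (mu : probability X R).
Context d' (Z : measurableType d').

Definition recovers (u : X -> Z) : Prop := forall A : set X, measurable A ->
  exists2 B : set Z, measurable B & {ae mu, forall x, B (u x) <-> A x}.

(* A dense sequence q_i is fixed. Outside of a null set, u x determines which
   balls of radius 1/(n+1) around the q_i contain x; where these data look like
   those of a Cauchy sequence, the inverse takes its limit. *)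
Lemma left_inverse (u : X -> Z) : standard_borel R X ->
  measurable_fun setT u -> recovers u ->
  exists2 S : Z -> X, measurable_fun setT S & {ae mu, forall x, S (u x) = x}.
Proof.
move=> [Y [phi [hY [D cD dD] [psi phiK psiK] mX]]] mu_ rec.
have [q dq] := dense_sequence cD dD.
pose r n : R := n.+1%:R^-1.
have r0 n : 0 < r n by rewrite /r invr_gt0.
have mcell n i : measurable (phi @^-1` cell q n i).
  by apply/mX; exists (cell q n i) => //; apply: sub_sigma_algebra;
    exact: open_interior.
have /choice[B BP] (ni : nat * nat) : exists B, measurable B /\
    {ae mu, forall x, B (u x) <-> cell q ni.1 ni.2 (phi x)}.
  by have [B mB aeB] := rec _ (mcell ni.1 ni.2); exists B.
have mB ni := (BP ni).1.
have aeB : {ae mu, forall x, forall n i, B (n, i) (u x) <-> cell q n i (phi x)}.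
  by apply: ae_foralln => n; apply: ae_foralln => i; exact: (BP (n, i)).2.
(* A point of [C] has a ball at every scale, and no two of its balls have centers farther apart than
   the sum of the radii allows. *)
pose C : set Z := \bigcap_n \bigcup_i B (n, i) `&`
  ~` \bigcup_(t in [set t | ~ ball (q t.1.2) (r t.1.1 + r t.2.1) (q t.2.2)])
       (B t.1 `&` B t.2).
have mC : measurable C.
  apply: measurableI.
    by apply: bigcapT_measurable => n; apply: bigcup_measurable.
  apply/measurableC/countable_bigcup_measurable => t _.
  exact: measurableI.
have limC z : exists y, C z -> forall n i, B (n, i) z -> ball (q i) (3 * r n) y.
  have [|nCz] := pselect (C z); last by exists point.
  move=> [Cz1 Cz2].
  have /choice[i iP] n : exists i, B (n, i) z by have [i _ Bi] := Cz1 n I; exists i.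
  have near_q n j m : B (n, j) z -> ball (q j) (r n + r m) (q (i m)).
    move=> Bj; apply: contrapT => nb; apply: Cz2.
    by exists ((n, j), (m, i m)) => //; split=> //=; exact: iP.
  have : cvg ((q \o i) @ \oo).
    apply/cauchy_cvgP/cauchy_exP => e e0.
    have [n ne] := small_radius 2 e0.
    exists (q (i n)), n => // m /= nm.
    apply: (@le_ball _ _ _ (r n + r m)); last by apply: near_q; exact: iP.
    rewrite (le_trans _ (ltW ne))// mulr_natl mulr2n lerD2l.
    by rewrite lef_pV2 ?posrE// ler_nat ltnS.
  move=> /cvg_ex[y qy]; exists y => _ n j Bj.
  have /cvg_ball/(_ (r n) (r0 n)) := qy; move=> [N _ Ny].
  (* From [q j] to a term of index [m >= n] costs [r n + r m <= 2 * r n]; from there to the limit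
     [y], another [r n]. *)
  rewrite (_ : 3 * r n = (r n + r n) + r n); last by ring.
  apply: (@ball_triangle _ _ (q (i (maxn n N)))).
    apply: le_ball (near_q n j (maxn n N) Bj).
    by rewrite lerD2l lef_pV2 ?posrE// ler_nat ltnS leq_maxl.
  by apply/ball_sym/Ny => /=; exact: leq_maxr.
have [S0 S0P] := choice limC.
(* With the value [point] off [C], the preimage of an open set is its trace on [C], enlarged by the
   complement of [C] exactly when the open set contains [point]. *)
pose S1 z := if pselect (C z) is left _ then S0 z else point.
have S1C z : C z -> S1 z = S0 z by rewrite /S1; case: pselect.
have mS1 U : open U -> measurable (S1 @^-1` U).
  move=> oU; pose V := C `&` \bigcup_(ni in [set ni : nat * nat |
      ball (q ni.2) (3 * r ni.1) `<=` U]) B ni.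
  have mV : measurable V.
    by apply: measurableI => //; exact: countable_bigcup_measurable.
  have UV z : C z -> U (S1 z) <-> V z.
    move=> Cz; rewrite (S1C _ Cz); split=> [Uz|[_ [[n i]/= qU Bz]]]; last first.
      exact/qU/S0P.
    move: oU; rewrite openE => /(_ _ Uz)/nbhs_ballP[e /= e0 eU].
    (* Six radii: [3 * r n] from the limit to [q i], and [3 * r n] from [q i] to any point of the
       ball. *)
    have [n ne] := small_radius 6 e0.
    have [i _ Bi] := Cz.1 n I.
    split=> //; exists (n, i) => //= y qy; apply/eU/(le_ball (ltW ne)).
    rewrite (_ : 6 * _ = 3 * r n + 3 * r n); last by rewrite /r; ring.
    by apply: ball_triangle qy; apply/ball_sym/S0P.
  have [Up|Up] := pselect (U point).
    rewrite (_ : _ @^-1` _ = V `|` ~` C).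
      by apply: measurableU => //; exact: measurableC.
    apply/seteqP; split=> z /=.
      by have [Cz|Cz] := pselect (C z); [move=> /(UV _ Cz); left|right].
    move=> [[Cz Vz]|nCz]; first by apply/UV => //; split.
    by rewrite /S1; case: pselect.
  rewrite (_ : _ @^-1` _ = V) //; apply/seteqP; split=> z /=.
    have [Cz|Cz] := pselect (C z); first by move=> /(UV _ Cz).
    by rewrite /S1; case: pselect.
  by move=> Vz; apply/UV => //; case: Vz.
have mS : measurable_fun setT (psi \o S1).
  move=> _ A /mX[A' bA' ->]; rewrite setTI.
  rewrite (_ : _ @^-1` _ = S1 @^-1` A'); first exact: preimage_measurable_sigma bA'.
  by apply/seteqP; split=> z /=; rewrite psiK.
exists (psi \o S1) => //.
apply: filterS aeB => x Bx /=.
have Cx : C (u x).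
  split=> [n _|[[[n i] [m j]]/= nb [/Bx ni /Bx mj]]].
    by have [i qi] := cell_cover dq n (phi x); exists i => //; apply/Bx.
  by apply/nb/(ball_triangle (cell_ball ni))/ball_sym/cell_ball.
rewrite (S1C _ Cx) -[RHS]phiK; congr psi.
(* Both points are near the same [q i], within [3 * r n] and [r n]; since [Y] is Hausdorff, points
   at arbitrarily small distance coincide. *)
apply: (close_eq hY); rewrite ball_close => e.
have [n ne] := small_radius 4 (gt0 e).
have [i qi] := cell_cover dq n (phi x).
apply: (le_ball (ltW ne)); rewrite (_ : 4 * _ = 3 * r n + r n);
  last by rewrite /r; ring.
apply: ball_triangle (cell_ball qi); apply: ball_sym.
by apply: S0P => //; apply/Bx.
Qed.

End left_inverse.

(** * Countable generation and embedding into the reals *)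

(** The cells around a dense sequence are a countable base of the topology of [Y]. Their preimages
    are enumerated through [pickle], with [set0] at numbers that code no pair. *)
Lemma standard_borel_countably_generated (R : realType) d (X : measurableType d) :
  standard_borel R X -> exists2 A : nat -> set X,
    forall n, measurable (A n) & forall B, measurable B -> <<s range A >> B.
Proof.
move=> [Y [phi [_ [D cD dD] _ mX]]].
have [q dq] := dense_sequence cD dD.
pose A k : set X := if unpickle k is Some ni then phi @^-1` cell q ni.1 ni.2
  else set0.
exists A => [n|B /mX[B' bB' ->]].
  rewrite /A; case: unpickle => [[m i]|]; last exact: measurable0.
  apply/mX; exists (cell q m i) => //; apply: sub_sigma_algebra.
  exact: open_interior.
apply: (@preimage_measurable_sigma _ (g_sigma_algebraType (range A)) Y open) =>
  // U oU.
rewrite (open_bigcup_cell dq (lexx 1) oU) preimage_bigcup.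
apply: countable_bigcup_measurable => ni _.
apply: sub_sigma_algebra; exists (pickle ni) => //.
by rewrite /A pickleK.
Qed.

Section base_three_expansion.
Context (R : realType) d (X : measurableType d) (A : nat -> set X).
Hypothesis mA : forall n, measurable (A n).

(* As the digits are 0 or 1, a tail is at most 3/2, and the leading digit of
   [ternary n] is 1 iff [ternary n >= 1]. *)
Fixpoint ternary_sum N n (x : X) : R :=
  if N is N'.+1 then \1_(A n) x + ternary_sum N' n.+1 x / 3 else 0.

Definition ternary n (x : X) : R := limn (fun N => ternary_sum N n x).

Lemma ternary_sum_ge0 N n x : 0 <= ternary_sum N n x.
Proof. by elim: N n => [//|N IH] n /=; rewrite addr_ge0// divr_ge0. Qed.

Lemma ternary_sum_le N n x : ternary_sum N n x <= 3 / 2.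
Proof.
elim: N n => [|N IH] n /=; first by lra.
have := IH n.+1; have : \1_(A n) x <= 1 :> R by rewrite indicE; case: (_ \in _).
by lra.
Qed.

Lemma cvg_ternary_sum n x : ternary_sum N n x @[N --> \oo] --> ternary n x.
Proof.
apply: nondecreasing_is_cvgn.
  apply/nondecreasing_seqP => N; elim: N n => [|N IH] n.
    exact: ternary_sum_ge0.
  by rewrite [leLHS]/= [leRHS]/= lerD2l ler_pM2r// IH.
by exists (3 / 2) => _ [N _ <-]; exact: ternary_sum_le.
Qed.

Lemma ternaryS n x : ternary n x = \1_(A n) x + ternary n.+1 x / 3.
Proof.
have c1 : ternary_sum N.+1 n x @[N --> \oo] --> ternary n x.
  by rewrite (cvg_shiftS (fun N => ternary_sum N n x)); exact: cvg_ternary_sum.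
apply: (cvg_unique _ c1) => //=.
by apply: cvgD; [exact: cvg_cst|apply: cvgMl; exact: cvg_ternary_sum].
Qed.

Lemma ternary_itv n x : 0 <= ternary n x <= 3 / 2.
Proof.
have cvgx : cvgn (fun N => ternary_sum N n x) by exact: cvg_ternary_sum.
rewrite /ternary; apply/andP; split.
  by apply: (limr_ge cvgx); apply: nearW => N; exact: ternary_sum_ge0.
by apply: (limr_le cvgx); apply: nearW => N; exact: ternary_sum_le.
Qed.

Lemma ternary_digit n x : (1 <= ternary n x) = (x \in A n).
Proof.
rewrite ternaryS; have /andP[] := ternary_itv n.+1 x.
by rewrite indicE; case: (_ \in _) => /= ? ?; [apply/idP|apply/negP]; lra.
Qed.

Lemma measurable_ternary n : measurable_fun setT (ternary n).
Proof.
apply: (@measurable_fun_cvg _ _ _ _ (fun N => ternary_sum N n)) => [N|x _].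
  elim: N n => [|N IH] n /=; first exact: measurable_cst.
  apply: measurable_funD; first exact: measurable_indic.
  by apply: measurable_funM => //; exact: measurable_cst.
exact: cvg_ternary_sum.
Qed.

(** The leading digit is the indicator of [[1, +oo[]; subtracting it and multiplying by 3 strips it
    off in a Borel way. Hence every digit is a Borel function of the whole expansion. *)
Lemma ternary_shift n : exists2 rho : R -> R, measurable_fun setT rho &
  forall x, ternary n x = rho (ternary 0 x).
Proof.
elim: n => [|n [rho mrho rhoE]]; first by exists id.
exists (fun t => 3 * (rho t - \1_(rho @^-1` `[1, +oo[) t)).
  apply: measurable_funM; first exact: measurable_cst.
  apply: measurable_funB => //; apply: measurable_indic.
  exact: measurable_preimage.
move=> x; rewrite -rhoE.
rewrite (_ : \1__ _ = \1_(A n) x); first by rewrite (ternaryS n); lra.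
rewrite !indicE -ternary_digit; congr (_%:R); congr nat_of_bool.
by apply/idP/idP; rewrite inE/= -rhoE in_itv/= andbT.
Qed.

Lemma ternary_generates (B : set X) : <<s range A >> B ->
  exists2 D : set R, measurable D & B = ternary 0 @^-1` D.
Proof.
have sG := sigma_algebra_preimage setT (ternary 0) (@sigma_algebra_measurable _
  (measurableTypeR R)).
move=> /(smallest_sub sG)[].
  move=> _ [n _ <-]; have [rho mrho rhoE] := ternary_shift n.
  exists (rho @^-1` `[1, +oo[); first exact: measurable_preimage.
  rewrite setTI; apply/seteqP; split=> x /=; rewrite -rhoE in_itv/= andbT.
    by rewrite ternary_digit inE.
  by rewrite ternary_digit => /mem_set.
by move=> D mD <-; exists D => //; rewrite setTI.
Qed.

End base_three_expansion.

Lemma real_embedding (R : realType) d (X : measurableType d) :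
  standard_borel R X -> exists g : X -> R, [/\ measurable_fun setT g,
    forall x, 0 < g x < 1 &
    forall A, measurable A -> exists2 D : set R, measurable D & A = g @^-1` D].
Proof.
move=> /standard_borel_countably_generated[A mA genA].
(* An affine map that sends [[0, 3/2]] to [[1/4, 5/8]], inside []0, 1[]. *)
pose h (t : R) := (t + 1) / 4; pose k (t : R) := t * 4 - 1.
have hK : cancel h k by move=> t; rewrite /h /k; lra.
exists (h \o ternary R A 0); split.
- apply: measurableT_comp (measurable_ternary mA _).
  by apply: measurable_funM => //; apply: measurable_funD.
- by move=> x; have := ternary_itv R A 0 x; rewrite /h/=; lra.
- move=> B /genA/(ternary_generates R)[D mD ->].
  exists (k @^-1` D).
    apply: measurable_preimage => //; apply: measurable_funB => //.
    exact: measurable_funM.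
  by apply/seteqP; split=> x /=; rewrite hK.
Qed.

(** * The probability integral transform of an atomless law *)

Section probability_integral_transform.
Context (R : realType) d (X : measurableType d) (mu : probability X R).
Variable h : {RV mu >-> R}.
Hypothesis no_atom : forall t, mu (h @^-1` [set t]) = 0%E.

Definition rcdf (t : R) : R := fine (cdf h t).

Lemma rcdfE t : (rcdf t)%:E = mu (h @^-1` `]-oo, t]).
Proof. by rewrite fineK// fin_num_measure. Qed.

Lemma rcdf_itv t : 0 <= rcdf t <= 1.
Proof.
apply/andP; split; rewrite -lee_fin rcdfE//.
by apply: probability_le1; exact: measurable_funPTI.
Qed.

Lemma rcdf_nondecreasing : {homo rcdf : s t / s <= t}.
Proof.
by move=> s t st; rewrite fine_le ?fin_num_measure// cdf_nondecreasing.
Qed.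

Lemma measurable_rcdf : measurable_fun setT rcdf.
Proof. exact: nondecreasing_measurable rcdf_nondecreasing. Qed.

Lemma measure_ltE t : mu (h @^-1` `]-oo, t[) = mu (h @^-1` `]-oo, t]).
Proof.
have tE : `]-oo, t]%classic = `]-oo, t[ `|` [set t] by rewrite setUitv1.
rewrite tE preimage_setU measureU;
  [|exact: measurable_funPTI|exact: measurable_funPTI|].
- by rewrite [X in (_ + X)%E]no_atom adde0.
- by rewrite -preimage_setI; apply/seteqP; split=> x //=;
  rewrite in_itv/= => -[/[swap]->]; rewrite ltxx.
Qed.

(** With [s] the supremum of the reals where [rcdf] is at most [t], the event lies between [h < s]
    and [h <= s]. These have the same measure for want of atoms; it is at most [t] by continuity
    from below and at least [t] by right continuity of the cdf. *)
Lemma rcdf_transform t : 0 <= t < 1 ->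
  mu [set x | rcdf (h x) <= t] = t%:E.
Proof.
move=> /andP[t0 t1]; pose E := [set r | rcdf r <= t].
(* If no value of [rcdf] is at most [t], the limit 0 at minus infinity forces [t = 0], and the event
   is empty. *)
have [Er|nE] := pselect (E !=set0); last first.
  suff t_le0 : t <= 0.
    rewrite (_ : [set x | _] = set0) ?measure0.
      by congr (_%:E); apply/eqP; rewrite eq_le t0.
    by apply/seteqP; split=> x //= xt; apply: nE; exists (h x).
  rewrite leNgt; apply/negP => t_gt0; apply: nE.
  have [M [_ /(_ (M - 1))]] := cvg_cdfNy0 h (nbhs_open_ereal_lt (f := fun=> t) t_gt0).
  by rewrite ltrBlDr ltrDl ltr01 /= -[cdf _ _]rcdfE lte_fin => /(_ isT)/ltW;
    exists (M - 1).
have supE : has_sup E.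
  split=> //.
  have [M [_ Mt]] := cvg_cdfy1 h (nbhs_open_ereal_gt (f := fun=> t) t1).
  exists M => r /= rt; rewrite leNgt; apply/negP => /Mt/=.
  by rewrite -[cdf _ _]rcdfE lte_fin ltNge rt.
pose s := sup E.
have ltsE r : r < s -> rcdf r <= t.
  by move=> /(sup_gt Er)[r' /= r't /ltW/rcdf_nondecreasing/le_trans]; apply.
have gtsE r : s < r -> t < rcdf r.
  by move=> sr; rewrite ltNge; apply/negP => rt; have := ub_le_sup supE.2 rt;
    rewrite leNgt sr.
have les : (mu (h @^-1` `]-oo, s[) <= t%:E)%E.
  rewrite (_ : `]-oo, s[%classic = \bigcup_n `]-oo, s - n.+1%:R^-1]%classic);
    last first.
    apply/seteqP; split=> r /=.
      rewrite in_itv/= -subr_gt0 => /(small_radius 1)[n nr]; exists n => //=.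
      by move: nr; rewrite in_itv/= mul1r lerBrDr -lerBrDl => /ltW.
    move=> [n _]/=; rewrite !in_itv/= => /le_lt_trans; apply.
    by rewrite ltrBlDr ltrDl.
  rewrite preimage_bigcup; have cvgmu : mu (h @^-1` `]-oo, s - n.+1%:R^-1]) @[n
    --> \oo] -->
      mu (\bigcup_n h @^-1` `]-oo, s - n.+1%:R^-1]).
    apply: nondecreasing_cvg_mu => [n||n m nm].
    - exact: measurable_funPTI.
    - by apply: bigcup_measurable => n _; exact: measurable_funPTI.
    - apply/subsetPset => x /=; rewrite !in_itv/= => /le_trans; apply.
      by rewrite lerD2l lerN2 lef_pV2 ?posrE// ler_nat ltnS.
  rewrite -(cvg_lim _ cvgmu)//; apply: lime_le; first by apply/cvg_ex; eexists;
    exact: cvgmu.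
  apply: nearW => n; rewrite -rcdfE lee_fin ltsE//.
  by rewrite ltrBlDr ltrDl.
have ges : (t%:E <= mu (h @^-1` `]-oo, s]))%E.
  have cvgs : cdf h r @[r --> s^'+] --> cdf h s by exact: cdf_right_continuous.
  rewrite -[leRHS](cvg_lim _ cvgs)//; apply: lime_ge; first by apply/cvg_ex;
    eexists; exact: cvgs.
  near=> r; rewrite -[cdf _ _]rcdfE lee_fin ltW// gtsE//.
have mF : measurable [set x | rcdf (h x) <= t].
  rewrite (_ : [set x | _] = (rcdf \o h) @^-1` `]-oo, t]).
    by apply: measurable_preimage => //; apply: measurableT_comp measurable_rcdf _.
  by apply/seteqP; split=> x /=; rewrite in_itv.
apply/eqP; rewrite eq_le; apply/andP; split.
  apply: le_trans les; rewrite measure_ltE; apply: le_measure; rewrite ?inE//.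
    exact: measurable_funPTI.
  by move=> x /= xt; rewrite in_itv/= leNgt; apply/negP => /gtsE; rewrite ltNge xt.
apply: (le_trans ges); rewrite -measure_ltE; apply: le_measure; rewrite ?inE//.
  exact: measurable_funPTI.
by move=> x /=; rewrite in_itv/=; exact: ltsE.
Unshelve. all: by end_near.
Qed.

Lemma rcdf_transform_clamp t :
  mu [set x | rcdf (h x) <= t] = (Num.max 0 (Num.min t 1))%:E.
Proof.
have [t0|t0] := ltP t 0.
  rewrite (_ : [set x | _] = set0) ?measure0; last first.
    by apply/seteqP; split=> x //= /le_lt_trans/(_ t0); have := rcdf_itv (h x); lra.
  by rewrite max_l// ge_min ltW.
rewrite max_r; last by rewrite le_min t0 ler01.
have [t1|t1] := ltP t 1; first by rewrite rcdf_transform ?t0.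
rewrite (_ : [set x | _] = setT) ?probability_setT//.
by apply/seteqP; split=> x //= _; have := rcdf_itv (h x); lra.
Qed.

(** One event contains the other by monotonicity, and both have probability [rcdf s], so they differ
    by a null set: flat stretches of the cdf carry no mass. *)
Lemma rcdf_transform_le s :
  {ae mu, forall x, rcdf (h x) <= rcdf s <-> h x <= s}.
Proof.
have mF : measurable [set x | rcdf (h x) <= rcdf s].
  rewrite (_ : [set x | _] = (rcdf \o h) @^-1` `]-oo, rcdf s]).
    by apply: measurable_preimage => //; apply: measurableT_comp measurable_rcdf _.
  by apply/seteqP; split=> x /=; rewrite in_itv.
have mH : measurable (h @^-1` `]-oo, s]) by exact: measurable_funPTI.
have HF : h @^-1` `]-oo, s] `<=` [set x | rcdf (h x) <= rcdf s].
  by move=> x /=; rewrite in_itv/=; exact: rcdf_nondecreasing.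
exists ([set x | rcdf (h x) <= rcdf s] `\` h @^-1` `]-oo, s]); split.
- exact: measurableD.
- rewrite measureD//; last by rewrite ltey_eq fin_num_measure.
  rewrite setIidr// [X in (X - _)%E]rcdf_transform_clamp -[X in (_ - X)%E]rcdfE.
  have /andP[s0 s1] := rcdf_itv s.
  by rewrite min_l// max_r// subee.
- move=> x /= /not_andP[/not_implyP[]|/not_implyP[xs]].
    by rewrite in_itv.
  by move=> []; exact: rcdf_nondecreasing.
Qed.

End probability_integral_transform.

(** * Uniform variables that remember a labelling *)

(** The sets recovered modulo null sets form a sigma-algebra, as countably many null sets have a
    null union. The map [f] allows sets of real values as well as subsets of [X] itself. *)
Lemma recovers_sigma (R : realType) d (X : measurableType d) (mu : probability X R)
    d' (Z : measurableType d') (u : X -> Z) (Y : Type) (f : X -> Y)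
    (G : set (set Y)) :
  (forall A, G A -> exists2 B : set Z, measurable B &
     {ae mu, forall x, B (u x) <-> A (f x)}) ->
  forall A, <<s G >> A -> exists2 B : set Z, measurable B &
     {ae mu, forall x, B (u x) <-> A (f x)}.
Proof.
move=> rG A; apply: (@smallest_sub _ _ _ [set A | exists2 B : set Z, measurable B &
  {ae mu, forall x, B (u x) <-> A (f x)}]) => //=.
split=> [|A' [B mB BA]|F rF] /=.
- by exists set0 => //; apply: aeW.
- exists (~` B); first exact: measurableC.
  by apply: filterS BA => x BA; split=> [nB|[_ nA]]; [split=> // /BA|move=> /BA].
- have /choice[B BP] n : exists B, measurable B /\ {ae mu, forall x, B (u x)
  <-> F n (f x)}.
    by have [B mB BF] := rF n; exists B.
  exists (\bigcup_n B n); first by apply: bigcupT_measurable => n; exact: (BP n).1.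
  have := ae_foralln (fun n => (BP n).2); apply: filterS => x Bx.
  by split=> -[n _ /Bx]; exists n.
Qed.

(** As [g] lies strictly between 0 and 1, [l] and [g] are the integer and fractional parts of [h],
    so [h] retains both. The threshold for [l x < j] is the distribution function of [h] at [j]. *)
Lemma labelled_uniform (R : realType) d (X : measurableType d) (mu : probability X R)
    (l : X -> nat) :
  standard_borel R X -> non_atomic mu -> measurable_fun setT l ->
  exists u : X -> R, [/\ measurable_fun setT u, recovers mu u,
    forall t, mu [set x | u x <= t] = (Num.max 0 (Num.min t 1))%:E &
    forall j, {ae mu, forall x, u x <= fine (mu [set x | (l x < j)%N]) <-> (l x
      < j)%N}].
Proof.
move=> sX naX ml; have [g [mg g01 gX]] := real_embedding sX.
pose h x : R := (l x)%:R + g x.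
have hle j x : (h x <= j%:R) = (l x < j)%N.
  have /andP[g0 g1] := g01 x; have [lj|jl] := ltnP (l x) j.
    have : (l x).+1%:R <= j%:R :> R by rewrite ler_nat.
    by rewrite -natr1 /h => ?; apply/idP; lra.
  have : j%:R <= (l x)%:R :> R by rewrite ler_nat.
  by rewrite /h => ?; apply/negP; lra.
have hl x y : h x = h y -> g x = g y.
  move=> hxy; have lxy : l x = l y; last by move: hxy; rewrite /h lxy; lra.
  have lxy' : (l x < (l y).+1)%N by rewrite -hle hxy hle.
  have lyx' : (l y < (l x).+1)%N by rewrite -hle -hxy hle.
  by apply/eqP; rewrite eqn_leq -ltnS lxy' -ltnS lyx'.
have mh : measurable_fun setT h.
  by apply: measurable_funD => //; apply: measurableT_comp ml.
pose H : {RV mu >-> R} := HB.pack h (isMeasurableFun.Build _ _ _ _ h mh).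
(* On a fibre of [h] the map [g] is constant, and measurable sets are preimages by [g]; so a
   measurable subset of a fibre is empty or everything, and a fibre of positive measure would be an
   atom. *)
have no_atom t : mu (H @^-1` [set t]) = 0%E.
  have mA : measurable (H @^-1` [set t]) by exact: measurable_funPTI.
  apply: contrapT => /eqP; rewrite -measure_gt0 => /(naX _ mA)[B [mB BA B0 BltA]].
  have [D mD BD] := gX _ mB.
  have [[b Bb]|nB] := pselect (B !=set0); last first.
    by move: B0; rewrite (_ : B = set0) ?measure0 ?ltxx//; apply/seteqP;
      split=> x // Bx; apply: nB; exists x.
  move: BltA; rewrite (_ : B = H @^-1` [set t]) ?ltxx//.
  apply/seteqP; split=> // x Hx; have Hb := BA _ Bb.
  by move: Bb; rewrite BD /= (@hl b x)//; rewrite [LHS]Hb.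
pose u := rcdf H \o h.
have mu_ : measurable_fun setT u by apply: measurableT_comp (measurable_rcdf H) _.
exists u; split => //.
- move=> A /gX[D mD ->].
  (* The copies of [D] translated into each []j, j + 1[], so that [h x] is in [D'] iff [g x] is in
     [D]. *)
  pose D' := \bigcup_(j : nat) (`]j%:R, j.+1%:R[ `&` (fun s : R => s - j%:R) @^-1` D).
  have mD' : measurable D'.
    apply: bigcupT_measurable => j; apply: measurableI => //.
    by apply: measurable_preimage => //; exact: measurable_funB.
  have [B mB BD] : exists2 B : set R, measurable B & {ae mu, forall x, B (u x)
    <-> D' (h x)}.
    have : <<s @RGenOInfty.G R >> D' by move: mD';
      rewrite [measurable](RGenOInfty.measurableE R).
    apply: recovers_sigma => _ [s ->]; exists `]rcdf H s, +oo[%classic => //.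
    apply: filterS (rcdf_transform_le no_atom s) => x us.
    by rewrite /= !in_itv/= !andbT !ltNge; split=> /negP nle; apply/negP => /us.
  exists B => //; apply: filterS BD => x ->; split=> [[j _ []]|Dx].
    rewrite /= in_itv/= => /andP[jh hj].
    have -> : j = l x.
      have lj : (l x < j.+1)%N by rewrite -hle ltW.
      by apply/eqP; rewrite eqn_leq -[(l x <= j)%N]ltnS lj andbT leqNgt -hle
        -ltNge jh.
    by rewrite /h addrAC subrr add0r.
  exists (l x) => //; split; last by rewrite /= /h addrAC subrr add0r.
  by have := g01 x; rewrite /= in_itv/= -natr1 /h; lra.
- by move=> t; exact: rcdf_transform_clamp.
- move=> j; have -> : fine (mu [set x | (l x < j)%N]) = rcdf H j%:R.
    congr fine; congr (mu _); apply/seteqP.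
    by split=> x; rewrite /= in_itv/= -hle.
  by apply: filterS (rcdf_transform_le no_atom j%:R) => x; rewrite -[H x]/(h x) hle.
Qed.

(** * Transport between equal laws, and relabelling by invertible maps *)

Section probability_space.
Context (R : realType) d (X : measurableType d) (mu : probability X R).

Lemma ae_eq_measure (A B : set X) : measurable A -> measurable B ->
  {ae mu, forall x, A x <-> B x} -> mu A = mu B.
Proof.
have le (C D : set X) : measurable C -> measurable D ->
    {ae mu, forall x, C x <-> D x} -> (mu C <= mu D)%E.
  move=> mC mD [N [mN N0 CDN]].
  rewrite -[leRHS]adde0 -N0 (le_trans _ (measureU2 _ mD mN))//.
  apply: le_measure; rewrite ?inE//; first exact: measurableU.
  move=> x Cx; have [Dx|nDx] := pselect (D x); [by left|right].
  by apply: CDN => /= CD; exact/nDx/CD.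
move=> mA mB AB; apply/eqP; rewrite eq_le !le//.
by apply: filterS AB => x [].
Qed.

Lemma ae_preserving (S : X -> X) (P : X -> Prop) : measure_preserving mu S ->
  {ae mu, forall x, P x} -> {ae mu, forall x, P (S x)}.
Proof.
move=> [mS pS] [N [mN N0 PN]]; exists (S @^-1` N); split.
- exact: measurable_preimage.
- by rewrite pS.
- by move=> x /= nP; exact: PN.
Qed.

Lemma preserving_ae_id d' (Z : measurableType d') (T : X -> Z) (S : Z -> X) :
  measurable_fun setT T -> measurable_fun setT S ->
  {ae mu, forall x, S (T x) = x} ->
  forall A, measurable A -> mu (T @^-1` (S @^-1` A)) = mu A.
Proof.
move=> mT mS ST A mA; apply: ae_eq_measure => //.
  by do 2 apply: measurable_preimage => //.
by apply: filterS ST => x /= ->.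
Qed.

Lemma eq_law (u v : X -> R) : measurable_fun setT u -> measurable_fun setT v ->
  (forall t, mu [set x | u x <= t] = mu [set x | v x <= t]) ->
  forall B, measurable B -> mu (u @^-1` B) = mu (v @^-1` B).
Proof.
move=> mu_ mv uv B mB.
pose U : {RV mu >-> R} := HB.pack u (isMeasurableFun.Build _ _ _ _ u mu_).
pose V : {RV mu >-> R} := HB.pack v (isMeasurableFun.Build _ _ _ _ v mv).
suff : distribution mu U B = distribution mu V B by [].
apply: (measure_unique (@RGenOInfty.G R) (fun n => `]- n%:R, +oo[%classic)) => //.
- exact: RGenOInfty.measurableE.
- move=> _ _ [x ->] [y ->]; exists (Num.max x y).
  by apply/seteqP; split=> z /=; rewrite !in_itv/= !andbT gt_max => /andP.
- by move=> n; exists (- n%:R).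
- apply/seteqP; split=> x //= _; exists (Num.truncn (- x)).+1 => //=.
  by rewrite in_itv/= andbT ltrNl truncnS_gt.
- move=> _ [t ->].
  have gtE (w : X -> R) : measurable_fun setT w ->
      mu (w @^-1` `]t, +oo[) = (1 - mu [set x | (w x <= t)%R])%E.
    move=> mw; rewrite -probability_setC; last first.
      rewrite (_ : [set x | _] = w @^-1` `]-oo, t]).
        exact: measurable_preimage.
      by apply/seteqP; split=> x /=; rewrite in_itv.
    congr (mu _); apply/seteqP; split=> x /=; rewrite in_itv/= andbT ltNge;
      by move/negP.
  by rewrite [LHS](gtE u mu_) uv -(gtE v mv).
- by move=> n; rewrite -ge0_fin_numE// fin_num_measure.
Qed.

Lemma measurable_eq d' (Z : measurableType d') (f g : Z -> R) :
  measurable_fun setT f -> measurable_fun setT g ->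
  measurable [set z | f z = g z].
Proof.
move=> mf mg; have := measurable_fun_eqr mf mg.
move=> /(_ measurableT [set true]); rewrite setTI.
rewrite (_ : _ @^-1` _ = [set z | f z = g z]); first exact.
by apply/seteqP; split=> z /= => [/eqP|fg]; [|apply/eqP].
Qed.

(** As [u] and [v] have the same law, [S \o v] has the law of [S \o u], which is [mu]. Likewise the
    set where [u \o S] is the identity has full measure for the law of [u], hence for that of
    [v]. *)
Lemma transport (u v : X -> R) (S : R -> X) :
  measurable_fun setT u -> measurable_fun setT v -> measurable_fun setT S ->
  (forall B, measurable B -> mu (u @^-1` B) = mu (v @^-1` B)) ->
  {ae mu, forall x, S (u x) = x} ->
  measure_preserving mu (S \o v) /\ {ae mu, forall x, u (S (v x)) = v x}.
Proof.
move=> mu_ mv mS uv Su; split.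
  split=> [|A mA]; first exact: measurableT_comp mS mv.
  rewrite -[RHS](preserving_ae_id mu_ mS Su mA) uv//.
  exact: measurable_preimage.
pose M : set R := [set t | u (S t) = t].
have mM : measurable M by apply: measurable_eq => //; exact: measurableT_comp.
exists (v @^-1` ~` M); split=> //; first exact/measurable_preimage/measurableC.
rewrite -uv; last exact: measurableC.
rewrite -[RHS](measure0 mu); apply: ae_eq_measure => //.
  exact/measurable_preimage/measurableC.
by apply: filterS Su => x /= ux; split=> //; apply; rewrite /M/= ux.
Qed.

(** Both variables are uniform, so [Su \o v] and [Sv \o u] are mutually inverse. The label of [S x]
    is read off [u (S x) = v x] by the thresholds [mu (l < j)]; those of [l \o T] are the same
    because [T] preserves [mu]. *)
Lemma relabel (l : X -> nat) (T : X -> X) :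
  standard_borel R X -> non_atomic mu -> measurable_fun setT l ->
  measure_preserving mu T ->
  exists S : X -> X, [/\ measure_preserving mu S, essentially_invertible mu S &
    {ae mu, forall x, l (S x) = l (T x)}].
Proof.
move=> sX naX ml pT; have [mT Tmu] := pT.
have mlT : measurable_fun setT (l \o T) by exact: measurableT_comp.
have [u [mu_ ru ulaw ul]] := labelled_uniform sX naX ml.
have [v [mv rv vlaw vl]] := labelled_uniform sX naX mlT.
have [Su mSu SuK] := left_inverse sX mu_ ru.
have [Sv mSv SvK] := left_inverse sX mv rv.
have uv : forall B, measurable B -> mu (u @^-1` B) = mu (v @^-1` B).
  by apply: eq_law => // t; rewrite ulaw vlaw.
have [pS uS] := transport mu_ mv mSu uv SuK.
have [pS' vS'] := transport mv mu_ mSv (fun B mB => esym (uv B mB)) SvK.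
exists (Su \o v); split=> //.
  exists (Sv \o u); split=> //.
    by apply: filterS2 uS SvK => x /= ->.
  by apply: filterS2 vS' SuK => x /= ->.
have := ae_preserving pS (ae_foralln ul).
apply: filterS3 uS (ae_foralln vl) => x ux vlx ulx.
have lE j : (l (Su (v x)) < j)%N <-> (l (T x) < j)%N.
  rewrite -(ulx j) -(vlx j) /= ux.
  by rewrite -(Tmu [set x | (l x < j)%N])//;
    apply: (@measurable_preimage _ _ _ _ l [set i | (i < j)%N]).
by apply/eqP; rewrite eqn_leq -ltnS; apply/andP; split; [apply/lE|rewrite -ltnS;
  apply/lE].
Qed.

End probability_space.

(** * Koopman operators on L^2 and the equality of the two topologies *)

Section koopman_L2.
Context (R : realType) d (X : measurableType d) (mu : probability X R).
Implicit Types (f g : X -> R) (S T : X -> X).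

Lemma Lfun_measurable f p : f \in Lfun mu p -> measurable_fun setT f.
Proof. by rewrite inE => /andP[/[!inE]]. Qed.

Lemma mpt_preserve (T : mpt mu) : measure_preserving mu T.
Proof. exact: asboolW (mpt_preserving T). Qed.

Lemma L2_mul_integrable f g : f \in Lfun mu 2%:E -> g \in Lfun mu 2%:E ->
  mu.-integrable setT (EFin \o (f \* g)).
Proof. by move=> fL gL; apply/Lfun1_integrable; exact: Lfun2_mul_Lfun1. Qed.

Lemma measurable_koopman S f : measure_preserving mu S ->
  measurable_fun setT f -> measurable_fun setT (koopman S f).
Proof. by move=> [mS _] mf; exact: measurableT_comp. Qed.

Lemma ge0_integral_preserving S (F : X -> \bar R) : measure_preserving mu S ->
  measurable_fun setT F -> (forall x, (0 <= F x)%E) ->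
  (\int[mu]_x F (S x) = \int[mu]_x F x)%E.
Proof.
move=> [mS pS] mF F0.
rewrite -[LHS](@ge0_integral_pushforward _ _ _ _ _ S mS mu setT F)//.
by apply: eq_measure_integral => A mA _; exact: pS.
Qed.

Lemma Lfun_koopman S f : measure_preserving mu S -> f \in Lfun mu 2%:E ->
  koopman S f \in Lfun mu 2%:E.
Proof.
move=> pS fL; have mf := Lfun_measurable fL.
move: fL; rewrite !inE => /andP[_]; rewrite inE/= => fL.
apply/andP; split; rewrite inE/=; first exact: measurable_koopman.
move: fL; rewrite /finite_norm unlock.
rewrite -(@ge0_integral_preserving S)//.
  apply/measurable_EFinP.
  by apply: (@measurableT_comp _ _ _ _ _ _ (fun x : R => x `^ 2)%R) => //;
    exact: measurableT_comp.
by move=> x; exact: poweR_ge0.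
Qed.

Lemma inner_koopman S f : measure_preserving mu S -> measurable_fun setT f ->
  inner_L2 mu (koopman S f) (koopman S f) = inner_L2 mu f f.
Proof.
move=> pS mf; rewrite /inner_L2 /Rintegral; congr fine.
apply: (@ge0_integral_preserving S (fun x => (f x * f x)%:E)) => //.
  by apply/measurable_EFinP; exact: measurable_funM.
by move=> x; rewrite lee_fin -expr2 sqr_ge0.
Qed.

Lemma Lnorm2_lt f e : measurable_fun setT f -> 0 < e ->
  ('N[mu]_2%:E[EFin \o f] < e%:E)%E =
  (\int[mu]_x (f x * f x)%:E < (e ^+ 2)%:E)%E.
Proof.
move=> mf e0.
have -> : (\int[mu]_x (f x * f x)%:E = 'N[mu]_2%:E[EFin \o f] `^ 2)%E.
  rewrite poweR_Lnorm//; apply: eq_integral => x _ /=.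
  by rewrite powR_mulrn// real_normK ?num_real// expr2.
have -> : (e ^+ 2)%:E = (e%:E `^ 2)%E by rewrite poweR_EFin powR_mulrn// ltW.
have N0 := Lnorm_ge0 mu 2%:E (EFin \o f).
have e0' : (0 <= e%:E)%E by rewrite lee_fin ltW.
apply/idP/idP; rewrite !ltNge; apply: contra => le.
  have r0 : 0 <= 2^-1 :> R by [].
  have := gt0_ler_poweR r0 _ _ le.
  rewrite -!poweRrM mulfV// !poweRe1//.
  by apply; rewrite in_itv/= leey andbT ?lee_fin ?powR_ge0 ?poweR_ge0.
by apply: gt0_ler_poweR => //; rewrite in_itv/= leey andbT.
Qed.

Lemma cauchy_schwarz f g : measurable_fun setT f -> measurable_fun setT g ->
  mu.-integrable setT (EFin \o (f \* g)) ->
  (`|inner_L2 mu f g|%:E <= 'N[mu]_2%:E[EFin \o f] * 'N[mu]_2%:E[EFin \o g])%E.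
Proof.
move=> mf mg ifg; rewrite EFin_normr_Rintegral//.
apply: (le_trans (le_abse_integral _ _ (measurable_int _ ifg))) => //.
rewrite -(Lnorm1 mu); apply: hoelder => //.
by rewrite [RHS]splitr !div1r.
Qed.

Lemma inner_koopmanB S T f g : measure_preserving mu S -> measure_preserving mu T ->
  f \in Lfun mu 2%:E -> g \in Lfun mu 2%:E ->
  inner_L2 mu (koopman S f \- koopman T f) g =
  inner_L2 mu (koopman S f) g - inner_L2 mu (koopman T f) g.
Proof.
move=> pS pT fL gL; rewrite /inner_L2 -RintegralB//.
- by apply: eq_Rintegral => x _ /=; rewrite mulrBl.
- by apply: L2_mul_integrable => //; exact: Lfun_koopman.
- by apply: L2_mul_integrable => //; exact: Lfun_koopman.
Qed.

Lemma strong_dist_lt (S T : mpt mu) f e : f \in Lfun mu 2%:E -> 0 < e ->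
  (strong_dist f S T < e%:E)%E =
  (2 * (inner_L2 mu (koopman T f) (koopman T f) -
        inner_L2 mu (koopman S f) (koopman T f)) < e ^+ 2).
Proof.
move=> fL e0; have [pS pT] := (mpt_preserve S, mpt_preserve T).
have mf := Lfun_measurable fL.
have [SL TL] := (Lfun_koopman pS fL, Lfun_koopman pT fL).
rewrite /strong_dist Lnorm2_lt//; last first.
  by apply: measurable_funB; exact: measurable_koopman.
have iSS := L2_mul_integrable SL SL; have iST := L2_mul_integrable SL TL.
have iTT := L2_mul_integrable TL TL.
have iSST : mu.-integrable setT (EFin \o ((koopman S f \* koopman S f) \-
  (koopman S f \* koopman T f))).
  exact: (integrableB measurableT iSS iST).
have iTST : mu.-integrable setT (EFin \o ((koopman T f \* koopman T f) \-
  (koopman S f \* koopman T f))).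
  exact: (integrableB measurableT iTT iST).
(* The square is grouped into two differences whose integrals agree, since [S] and [T] both preserve
   the norm of [f]. *)
have -> : (\int[mu]_x ((koopman S f \- koopman T f) x * (koopman S f \- koopman
  T f) x)%:E)%E
  = (\int[mu]_x ((koopman S f \* koopman S f \- koopman S f \* koopman T f) x +
                (koopman T f \* koopman T f \- koopman S f \* koopman T f) x))%:E.
  rewrite /Rintegral fineK.
    by apply: eq_integral => x _ /=; congr EFin; ring.
  by apply: integrable_fin_num => //; exact: (integrableD measurableT iSST iTST).
rewrite lte_fin RintegralD//= RintegralB// RintegralB//.
rewrite [X in X - _ + _](inner_koopman pS mf) -(inner_koopman pT mf).
by rewrite mulr_natl mulr2n.
Qed.

End koopman_L2.

Lemma strong_open_weak_open (R : realType) d (X : measurableType d)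
    (mu : probability X R) (U : set (mpt mu)) : open U <-> weak_open U.
Proof.
have strong_weak (T : mpt mu) : nbhs T `<=` nbhs (T : mpt_weak mu).
  apply: (strong_cvgP T (nbhs_filter (T : mpt_weak mu))).2 => f fL e e0.
  have TL := Lfun_koopman (mpt_preserve T) fL.
  (* Testing against [koopman T f] itself makes the weak distance half of the squared strong one. *)
  have /cvgrPdist_lt/(_ (e ^+ 2 / 2)) :=
    (weak_cvgP _ (nbhs_filter (T : mpt_weak mu))).1 (@cvg_refl _ _) f (koopman
      T f) fL TL.
  rewrite divr_gt0// ?exprn_gt0// => /(_ isT) near_T.
  apply: (@filterS _ _ (nbhs_filter (T : mpt_weak mu)) _ _ _ near_T) => S.
  rewrite strong_dist_lt// ltr_pdivlMr// mulrC.
  by apply: le_lt_trans; rewrite ler_pM2l// ler_norm.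
have weak_strong (T : mpt mu) : nbhs (T : mpt_weak mu) `<=` nbhs T.
  apply: (weak_cvgP (T : mpt_weak mu) (nbhs_filter T)).2 => f g fL gL;
    apply/cvgrPdist_lt => e e0.
  have gfin : 'N[mu]_2%:E[EFin \o g]%E \is a fin_num.
    by rewrite ge0_fin_numE ?Lnorm_ge0//; move: gL; rewrite inE => /andP[_];
      rewrite inE.
  (* Adding 1 keeps the divisor positive even when [g] has norm 0. *)
  pose M := fine 'N[mu]_2%:E[EFin \o g]%E + 1.
  have M0 : 0 < M by rewrite ltr_wpDl// fine_ge0// Lnorm_ge0.
  have := (strong_cvgP _ (nbhs_filter T)).1 (@cvg_refl _ _) f fL (e / M)
    (divr_gt0 e0 M0).
  apply: filterS => S dS.
  have [pS pT] := (mpt_preserve S, mpt_preserve T).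
  have [mf mg] := (Lfun_measurable fL, Lfun_measurable gL).
  rewrite distrC -inner_koopmanB// -lte_fin.
  apply: le_lt_trans (cauchy_schwarz _ _ _) _ => //.
  - apply: measurable_funB; first exact: (measurable_koopman pS mf).
    exact: (measurable_koopman pT mf).
  - rewrite (_ : _ \o _ = (EFin \o ((koopman S f \* g) \- (koopman T f \* g)))).
      exact: (integrableB measurableT (L2_mul_integrable (Lfun_koopman pS fL) gL)
        (L2_mul_integrable (Lfun_koopman pT fL) gL)).
    by apply/funext => x /=; rewrite mulrBl.
  rewrite -(fineK gfin); apply: (@le_lt_trans _ _ ((e / M)%:E * (fine
    'N[mu]_2%:E[EFin \o g])%:E)%E).
    by apply: lee_wpmul2r; [rewrite lee_fin fine_ge0// Lnorm_ge0|exact: ltW].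
  by rewrite -EFinM lte_fin mulrAC ltr_pdivrMr// ltr_pM2l// /M ltrDl.
rewrite /weak_open !openE; split=> oU T /oU; [exact: strong_weak|exact: weak_strong].
Qed.

(** * Density of the invertible transformations *)

Section approximation.
Context (R : realType) d (X : measurableType d) (mu : probability X R).

Lemma essentially_invertible_ae (S T : X -> X) :
  {ae mu, forall x, S x = T x} ->
  essentially_invertible mu T -> essentially_invertible mu S.
Proof.
move=> ST [T' [pT' T'T TT']]; exists T'; split=> //.
- by apply: filterS2 ST T'T => x ->.
- by apply: filterS2 (ae_preserving pT' ST) TT' => x ->.
Qed.

(** A basic set consists of the invertible [S] that agree with [T] up to a countable labelling.
    Convergence of this filter to [T] reduces density to [relabel], which makes the basic sets
    nonempty. *)
Definition label_filter (T : X -> X) : set_system (mpt mu) :=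
  [set A | exists2 l : X -> nat, measurable_fun setT l &
    forall S : mpt mu, mpt_inv mu S -> {ae mu, forall x, l (S x) = l (T x)} -> A S].

Lemma measurable_label (I : countType) (l : X -> I) :
  (forall i, measurable (l @^-1` [set i])) ->
  measurable_fun setT (pickle \o l).
Proof.
move=> ml _ B _; rewrite setTI.
rewrite (_ : _ @^-1` _ = \bigcup_(i in [set i | B (pickle i)]) l @^-1` [set i]).
  exact: countable_bigcup_measurable.
by apply/seteqP; split=> [x Bx|x [i /= Bi ->]//]; exists (l x).
Qed.

Lemma label_filter_filter (T : X -> X) : Filter (label_filter T).
Proof.
split=> [|A B [l ml lA] [k mk kB]|A B AB [l ml lA]].
- by exists (cst 0%N).
(* The pair of labels refines both labellings. *)
- exists (pickle \o (fun x => (l x, k x))).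
    apply: measurable_label => -[i j].
    rewrite (_ : _ @^-1` _ = l @^-1` [set i] `&` k @^-1` [set j]).
      by apply: measurableI; exact: measurable_preimage.
    by apply/seteqP; split=> x /= [li kj]; [split|rewrite li kj].
  move=> S iS /= lkS; split; [apply: lA|apply: kB] => //; apply: filterS lkS => x.
    by move=> /(pcan_inj pickleK)[].
  by move=> /(pcan_inj pickleK)[].
- by exists l => // S iS /(lA _ iS)/AB.
Qed.

Lemma label_filter_cvg (T : mpt mu) : label_filter T --> T.
Proof.
apply: (strong_cvgP T (label_filter_filter T)).2 => f fL e e0.
have mf := Lfun_measurable fL.
have e20 : 0 < e / 2 by rewrite divr_gt0.
(* Equal labels put [f (S x)] and [f (T x)] within [e / 2]; the halving keeps the inequality strict
   after integration over a probability space. *)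
exists (pickle \o (fun x => Num.floor (f x / (e / 2)))) => [|S iS fST].
  apply: measurable_label => z.
  rewrite (_ : _ @^-1` _ = (fun x => f x / (e / 2)) @^-1` `[z%:~R, (z + 1)%:~R[).
    by apply: measurable_preimage => //; exact: measurable_funM.
  apply/seteqP; split=> x /=; rewrite in_itv/=.
    by move=> <-; exact: floor_itv.
  exact: floor_def.
have [pS pT] := (mpt_preserve S, mpt_preserve T).
have mST : measurable_fun setT (koopman S f \- koopman T f).
  apply: measurable_funB; first exact: (measurable_koopman pS mf).
  exact: (measurable_koopman pT mf).
rewrite /strong_dist Lnorm2_lt//.
apply: (@le_lt_trans _ _ (\int[mu]_x (cst ((e / 2) ^+ 2)%:E x))%E).
  apply: ae_ge0_le_integral => //.
  - by move=> x _; rewrite lee_fin -expr2 sqr_ge0.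
  - by apply/measurable_EFinP; exact: measurable_funM.
  - by move=> x _; rewrite lee_fin sqr_ge0.
  - apply: filterS fST => x /(pcan_inj pickleK) fxy _.
    rewrite lee_fin -expr2 -[leLHS]real_normK ?num_real//.
    rewrite ler_sqr ?nnegrE ?(ltW e20)//.
    rewrite /koopman/= -[leRHS]mul1r -ler_pdivrMr// -[X in _ / X]gtr0_norm//
      -normf_div.
    have := floor_itv (f (S x) / (e / 2)); have := floor_itv (f (T x) / (e / 2)).
    rewrite fxy mulrBl; move: (Num.floor _) => z.
    by rewrite intrD => /andP[a b] /andP[a' b']; rewrite ler_norml; lra.
by rewrite integral_cst// [X in (_ * X)%E]probability_setT mule1 lte_fin; nra.
Qed.

Lemma mpt_inv_dense : standard_borel R X -> non_atomic mu -> dense (mpt_inv mu).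
Proof.
move=> sX naX O [T OT] oO.
have /label_filter_cvg[l ml lO] : nbhs T O by move: oO; rewrite openE; exact.
have [S [pS iS lS]] := relabel sX naX ml (mpt_preserve T).
have [c cS] := mpt_of_fun pS.
have ic : mpt_inv mu c by exact: essentially_invertible_ae cS iS.
exists c; split=> //; apply: lO => //.
by apply: filterS2 cS lS => x ->.
Qed.

End approximation.

(** * The invertible transformations form a countable intersection of open sets *)

Section Gdelta.
Context (R : realType) d (X : measurableType d) (mu : probability X R).

Lemma indic_Lfun (B : set X) : measurable B -> (\1_B : X -> R) \in Lfun mu 2%:E.
Proof.
move=> mB; rewrite inE; apply/andP; split; rewrite inE/=;
  first exact: measurable_indic.
apply: (@lt_trans _ _ 2%:E); last exact: ltry.
rewrite Lnorm2_lt//.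
under eq_integral do rewrite indicE -natrM mulnb andbb -indicE.
rewrite integral_indic// setIT (le_lt_trans (probability_le1 _ _))//.
by rewrite lte_fin -natrX ltr1n.
Qed.

Lemma measurable_discrepancy (B : set X) (S T : X -> X) : measurable B ->
  measurable_fun setT S -> measurable_fun setT T ->
  measurable [set x | ~ (B (S x) <-> B (T x))].
Proof.
move=> mB mS mT.
have mSB : measurable (S @^-1` B) by exact: measurable_preimage.
have mTB : measurable (T @^-1` B) by exact: measurable_preimage.
rewrite (_ : [set x | _] = (S @^-1` B `\` T @^-1` B) `|` (T @^-1` B `\` S @^-1` B)).
  by apply: measurableU; exact: measurableD.
apply/seteqP; split=> x /=; rewrite /setD/=;
  by case: (pselect (B (S x))); case: (pselect (B (T x))); tauto.
Qed.

(** The squared difference of the two indicators is the indicator of the discrepancy set, so the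
    squared distance is its measure. *)
Lemma indic_dist_measure (B : set X) (S T : mpt mu) e : measurable B -> 0 < e ->
  (strong_dist \1_B S T < e%:E)%E ->
  (mu [set x | ~ (B (S x) <-> B (T x))] < (e ^+ 2)%:E)%E.
Proof.
move=> mB e0; have [[mS _] [mT _]] := (mpt_preserve S, mpt_preserve T).
have mD := measurable_discrepancy mB mS mT.
rewrite /strong_dist Lnorm2_lt//; last first.
  by apply: measurable_funB; apply: measurableT_comp => //; exact: measurable_indic.
rewrite -[X in mu X]setIT -integral_indic//.
apply: le_lt_trans; rewrite le_eqVlt; apply/orP; left; apply/eqP.
apply: eq_integral => x _; rewrite /koopman/= !indicE; congr EFin.
have inB y : (y \in B) = `[< B y >] by apply/idP/asboolP; rewrite inE.
rewrite !inB (_ : (x \in _) = `[< ~ (B (S x) <-> B (T x)) >]); last first.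
  by apply/idP/asboolP; rewrite inE.
case: asboolP => Dx; case: asboolP => BS; case: asboolP => BT; rewrite /=;
  try tauto; lra.
Qed.

(** The bounds on [mu D] are summable, so by Borel-Cantelli almost every point lies in finitely many
    exceptional sets; the lower limit of the approximating sets is then the required one. *)
Lemma recovers_of_approx (T : X -> X) (A : set X) : measurable_fun setT T ->
  (forall m, exists2 B : set X, measurable B & exists2 D : set X,
     measurable D /\ (mu D <= (1 / (2 ^ m.+1)%:R)%:E)%E &
     {ae mu, forall x, ~ D x -> B (T x) <-> A x}) ->
  exists2 B : set X, measurable B & {ae mu, forall x, B (T x) <-> A x}.
Proof.
move=> mT approx.
have /choice[BD BDP] m : exists BD : set X * set X, [/\ measurable BD.1,
    measurable BD.2, (mu BD.2 <= (1 / (2 ^ m.+1)%:R)%:E)%E &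
    {ae mu, forall x, ~ BD.2 x -> BD.1 (T x) <-> A x}].
  by have [B mB [D [mD Dle] aeB]] := approx m; exists (B, D).
pose B m := (BD m).1; pose D m := (BD m).2.
have mB m : measurable (B m) by have [] := BDP m.
have mD m : measurable (D m) by have [] := BDP m.
have aeB : {ae mu, forall x, forall m, ~ D m x -> B m (T x) <-> A x}.
  by apply: ae_foralln => m; have [] := BDP m.
have D0 : mu (lim_sup_set D) = 0%E.
  apply: lim_sup_set_cvg0 => //.
  apply: (@le_lt_trans _ _ 1%:E); last exact: ltry.
  apply: le_trans (epsilon_trick0 xpredT ler01).
  by apply: lee_nneseries => // m _; have [] := BDP m.
exists (\bigcup_n \bigcap_(m in [set m | (n <= m)%N]) B m).
  by apply: bigcupT_measurable => n; apply: bigcap_measurableType.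
have aeD : {ae mu, forall x, ~ lim_sup_set D x}.
  exists (lim_sup_set D); split=> // [|x /= /contrapT//].
  by apply: bigcapT_measurable => n; apply: bigcup_measurable.
apply: filterS2 aeB aeD => x Bx nDx.
have [n nD] : exists n, forall m, (n <= m)%N -> ~ D m x.
  apply: contrapT => /forallNP nD; apply: nDx => n _.
  by have /existsNP[m /not_implyP[nm /contrapT Dm]] := nD n; exists m.
split=> [[k _ Bk]|Ax].
  apply/(Bx (maxn n k)); first by apply: nD; exact: leq_maxl.
  by apply: Bk => /=; exact: leq_maxr.
by exists n => // m /= nm; apply/Bx => //; exact: nD.
Qed.

Lemma recovers_essentially_invertible (T : X -> X) : standard_borel R X ->
  measure_preserving mu T -> recovers mu T -> essentially_invertible mu T.
Proof.
move=> sX [mT pT] rT.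
have [S mS ST] := left_inverse sX mT rT.
have pS : measure_preserving mu S.
  split=> // A mA; rewrite -pT; last exact: measurable_preimage.
  exact: preserving_ae_id.
exists S; split=> //.
(* The identity [T (S z) = z] is clear on the image of [T]. Comparing through the real map [g] makes
   the set where it holds measurable, so that [pT] applies; [k] then undoes [g]. *)
have [g [mg _ gX]] := real_embedding sX.
have rg : recovers mu g by move=> A /gX[D mD ->]; exists D => //; exact: aeW.
have [k _ kg] := left_inverse sX mg rg.
have pTS : measure_preserving mu (T \o S).
  split=> [|A mA]; first exact: measurableT_comp.
  by rewrite comp_preimage pS.2 ?pT//; exact: measurable_preimage.
have gTS : {ae mu, forall z, g (T (S z)) = g z}.
  pose M := [set z | g (T (S z)) = g z].
  have mM : measurable M.
    apply: measurable_eq => //; do 2 apply: measurableT_comp => //.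
  exists (~` M); split=> //; first exact: measurableC.
  rewrite -pT; last exact: measurableC.
  rewrite -[RHS](measure0 mu); apply: ae_eq_measure => //.
    exact/measurable_preimage/measurableC.
  by apply: filterS ST => x /= STx; split=> //; apply; rewrite /M/= STx.
by apply: filterS3 (ae_preserving pTS kg) gTS kg => z /= kTS gz kz; rewrite -kTS gz.
Qed.

Lemma mpt_inv_Gdelta : standard_borel R X -> Gdelta (mpt_inv mu).
Proof.
move=> sX; have [A mA genA] := standard_borel_countably_generated sX.
pose e m : R := (2 ^ m.+1)%:R^-1.
have e0 m : 0 < e m by rewrite invr_gt0 ltr0n expn_gt0.
(* Balls are taken around pairs of an invertible map and a set that it pulls back to [A n] modulo
   null sets; interiors make the union open. *)
pose O n m := \bigcup_(SB in [set SB : mpt mu * set X | [/\ mpt_inv mu SB.1,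
  measurable SB.2 &
  {ae mu, forall x, SB.2 (SB.1 x) <-> A n x}]]) (strong_ball \1_(SB.2) SB.1 (e m))°.
pose F k := let nm := odflt (0, 0)%N (unpickle k) in O nm.1 nm.2.
exists F => [k|].
  by apply: bigcup_open => SB _; exact: open_interior.
apply/seteqP; split=> [T iT k _|T FT].
  rewrite /F; move: (odflt _ _) => [n m] /=.
  (* An invertible [T] is the center of its own ball, with the preimage of [A n] under the inverse
     as the set. *)
  have [S [pS ST TS]] := iT.
  have mB : measurable (S @^-1` A n) by exact: measurable_preimage pS.1 (mA n).
  exists (T, S @^-1` A n); first split=> //=.
    by apply: filterS ST => x /= ->.
  apply: ((strong_cvgP T (nbhs_filter T)).1 (@cvg_refl _ _) _ _ _ (e0 m)).
  exact: indic_Lfun.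
have OT n m : O n m T by have := FT (pickle (n, m)) I; rewrite /F pickleK.
apply: (recovers_essentially_invertible sX (mpt_preserve T)) => B /genA.
apply: (recovers_sigma (f := id)) => _ [n _ <-].
apply: recovers_of_approx => [|m]; first exact: (mpt_preserve T).1.
have [[S B'] [/= iS mB' B'A] /interior_subset ball_T] := OT n m.
exists B' => //; exists [set x | ~ (B' (T x) <-> B' (S x))]; first split.
- exact: measurable_discrepancy mB' (mpt_preserve T).1 (mpt_preserve S).1.
(* The measure is below [e m ^+ 2], which is at most [e m] because [e m <= 1]. *)
- have := indic_dist_measure mB' (e0 m) ball_T => /ltW/le_trans; apply.
  rewrite lee_fin div1r /e expr2 ger_pMl ?invr_gt0 ?ltr0n ?expn_gt0//.
  by rewrite invf_le1 ?ltr0n ?expn_gt0// ler1n expn_gt0.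
- by apply: filterS B'A => x SA /=; rewrite -SA => /contrapT.
Qed.

End Gdelta.

Theorem theorem1p1 (R : realType) (d : measure_display) (X : measurableType d)
    (mu : probability X R) :
  standard_borel R X -> non_atomic mu ->
  (forall U : set (mpt mu), open U <-> weak_open U) /\
  dense (mpt_inv mu) /\
  Gdelta (mpt_inv mu).
Proof.
move=> sX naX; split; first exact: strong_open_weak_open.
by split; [exact: mpt_inv_dense|exact: mpt_inv_Gdelta].
Qed.
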